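(* For every integer $k\ge 3$ there exist real constants $A_k,B_k,C_k,D_k,E_k,F_k,G_k$ such that the polynomial identity $$P_k(x)=A_k\left[(x^2+B_kx+C_k)\,P_{k-2}(x)+(D_kx^3+E_kx^2+F_kx+G_k)\,P^{(1)}_{k-3}(x)\right]$$ holds.
   Context: Let $(c_i)_{i\ge 0}$ be a sequence of real numbers and let $c$ be the linear functional on the space of real polynomials in one variable defined by $c(x^i)=c_i$ for $i\ge 0$. (In the application to the Lanczos method for $A\mathbf{x}=\mathbf{b}$ one has $c_i=(\mathbf{y},A^i\mathbf{r}_0)$.) Let $c^{(1)}$ be the linear functional defined by $c^{(1)}(x^i)=c(x^{i+1})=c_{i+1}$. Standing assumptions: for every $n\ge 1$ the Hankel determinant $H^{(1)}_n=\det(c_{i+j+1})_{0\le i,j\le n-1}$ is nonzero. Consequently, for every $n\ge 0$ there is a unique polynomial $P_n$ of degree at most $n$ with $P_n(0)=1$ and $c(x^iP_n)=0$ for $0\le i\le n-1$, and a unique monic polynomial $P^{(1)}_n$ of degree $n$ with $c^{(1)}(x^iP^{(1)}_n)=0$ for $0\le i\le n-1$ (so $P_0=P_0^{(1)}=1$). Moreover $\{P_n\}$ is an orthogonal polynomial sequence with respect to $c$, meaning that for every $n\ge 0$ the polynomial $P_n$ has degree exactly $n$ and $c(x^nP_n)\ne 0$. *)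

(* Defs.v *)
From HB Require Import structures.
From mathcomp Require Import all_boot all_order all_algebra.
From mathcomp Require Import reals.

Set Implicit Arguments.
Unset Strict Implicit.
Unset Printing Implicit Defensive.

Import Order.TTheory GRing.Theory Num.Theory.
Local Open Scope ring_scope.

Section Moments.
Variable R : realType.
Implicit Types (c : nat -> R) (p : {poly R}).

Definition moment_functional c p : R := \sum_(i < size p) p`_i * c i.

Lemma moment_functionalE c p n : (size p <= n)%N ->
  moment_functional c p = \sum_(i < n) p`_i * c i.
Proof.
move=> le_pn; rewrite /moment_functional (big_ord_widen n (fun i => p`_i * c i)) //.
rewrite [RHS](bigID (fun i : 'I_n => (i < size p)%N)) /= [X in _ + X]big1 ?addr0 //.
by move=> i; rewrite -leqNgt => le_pi; rewrite nth_default // mul0r.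
Qed.

Lemma moment_functional_is_linear c : scalar (moment_functional c).
Proof.
move=> a p q; pose n := maxn (size (a *: p + q)) (maxn (size p) (size q)).
rewrite !(@moment_functionalE c _ n) ?leq_max ?leqnn ?orbT //.
rewrite mulr_sumr -big_split /=; apply: eq_bigr => i _.
by rewrite coefD coefZ mulrDl mulrA.
Qed.

HB.instance Definition _ c :=
  GRing.isLinear.Build R {poly R} R *%R (moment_functional c)
    (moment_functional_is_linear c).

Lemma moment_functionalXn c i : moment_functional c 'X^i = c i.
Proof.
rewrite /moment_functional size_polyXn big_ord_recr /= coefXn eqxx mul1r.
rewrite big1 ?add0r // => j _; rewrite coefXn (ltn_eqF (ltn_ord j)).
by rewrite mul0r.
Qed.

Definition moment_functional1 c : {poly R} -> R :=
  moment_functional (fun i => c i.+1).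

Definition hankel1 c n : R := \det (\matrix_(i < n, j < n) c (i + j + 1)%N).

(* The size of a polynomial is its degree plus one. *)
Definition is_P c n p : Prop :=
  [/\ (size p <= n.+1)%N, p.[0] = 1
    & forall i, (i < n)%N -> moment_functional c ('X^i * p) = 0].

Definition is_P1 c n p : Prop :=
  [/\ p \is monic, size p = n.+1
    & forall i, (i < n)%N -> moment_functional1 c ('X^i * p) = 0].

(* The vanishing of c (x^i P_n) for i < n is part of is_P, hence not repeated. *)
Definition orthogonal_sequence c (P : nat -> {poly R}) : Prop :=
  forall n, size (P n) = n.+1 /\ moment_functional c ('X^n * P n) <> 0.

End Moments.

(* Main.v *)
Require Import Defs.
From mathcomp Require Import all_boot all_order all_algebra.
From mathcomp Require Import reals.
From mathcomp Require Import ring.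

Import GRing.Theory.
Local Open Scope ring_scope.

(** Orthogonality with respect to [c^(1)] determines a polynomial of degree at
    most [m] up to a scalar.  Applied to [(P_{m+1} - P_m) / x] and to
    [P_m - a P^(1)_m], where [a] is the leading coefficient of [P_m], this gives
    [P_{m+1} = P_m + l x P^(1)_m] and [P_m = a P^(1)_m + b P^(1)_{m-1}], with
    [l] and [a] nonzero because [P_m] has degree exactly [m].  Two steps of these
    recurrences express [P_{m+2}] through [P_m] and [P^(1)_{m-1}]; the cubic
    factor of the latter even has degree at most two. *)

Section Orthogonality.
Set Implicit Arguments.
Unset Strict Implicit.
Context {R : realType} (c : nat -> R).

Lemma moment_functional1E (p : {poly R}) :
  moment_functional1 c p = moment_functional c ('X * p).
Proof.
rewrite (@moment_functionalE _ c _ (size p).+1); last first.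
  by rewrite (leq_trans (size_polyMleq _ _)) // size_polyX.
rewrite big_ord_recl coefXM mul0r add0r.
by apply: eq_bigr => i _; rewrite coefXM.
Qed.

Lemma moment_functional1XnM (p : {poly R}) m i : (size p <= m)%N ->
  moment_functional1 c ('X^i * p) = \sum_(j < m) p`_j * c (i + j + 1)%N.
Proof.
move=> le_pm; have -> : p = \sum_(j < m) p`_j *: 'X^j.
  rewrite -poly_def; apply/polyP => j; rewrite coef_poly.
  by case: ltnP => // le_mj; rewrite nth_default // (leq_trans le_pm).
rewrite mulr_sumr /moment_functional1 linear_sum; apply: eq_bigr => j _.
rewrite -scalerAr -exprD linearZ /= moment_functionalXn addn1.
congr (_ * _); rewrite -poly_def coef_poly ltn_ord //.
Qed.

(** The [m] orthogonality conditions form a square linear system in the [m] coefficients of [q],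
    whose matrix is the Hankel matrix, invertible by hypothesis. *)
Lemma moment_functional1_orth_eq0 m (q : {poly R}) :
  hankel1 c m <> 0 -> (size q <= m)%N ->
  (forall i, (i < m)%N -> moment_functional1 c ('X^i * q) = 0) -> q = 0.
Proof.
move=> /eqP det_neq0 le_qm orth_q.
set H := (\matrix_(i < m, j < m) c (i + j + 1)%N); pose v := \col_(j < m) q`_j.
have Hv0 : H *m v = 0.
  apply/matrixP => i j; rewrite !mxE -[RHS](orth_q i) //.
  rewrite (moment_functional1XnM _ le_qm).
  by apply: eq_bigr => l _; rewrite !mxE mulrC.
have v0 : v = 0.
  have H_unit : H \in unitmx by rewrite unitmxE unitfE.
  by rewrite -(mulKmx H_unit v) Hv0 mulmx0.
apply/polyP => j; rewrite coef0; case: (ltnP j m) => [lt_jm | le_mj].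
  by have /matrixP/(_ (Ordinal lt_jm) 0) := v0; rewrite !mxE.
by rewrite nth_default // (leq_trans le_qm).
Qed.

Lemma size_subZ_monic m (p q : {poly R}) :
  p \is monic -> size p = m.+1 -> (size q <= m.+1)%N ->
  (size (q - q`_m *: p)%R <= m)%N.
Proof.
move=> /monicP lead_p size_p le_q; apply/leq_sizeP => j le_mj.
rewrite coefB coefZ; move: le_mj; rewrite leq_eqVlt => /predU1P[<- | lt_mj].
  by move: lead_p; rewrite lead_coefE size_p /= => ->; rewrite mulr1 subrr.
rewrite [q`_j]nth_default ?(leq_trans le_q) //.
by rewrite [p`_j]nth_default ?size_p // mulr0 subrr.
Qed.

(** Subtracting the multiple of [p] that cancels the coefficient of degree [m] leaves a polynomial
    of degree below [m] that is still orthogonal, hence zero. *)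
Lemma moment_functional1_orth_proportional m (p q : {poly R}) :
  hankel1 c m <> 0 -> is_P1 c m p -> (size q <= m.+1)%N ->
  (forall i, (i < m)%N -> moment_functional1 c ('X^i * q) = 0) ->
  q = q`_m *: p.
Proof.
move=> hankel_neq0 [mon_p size_p orth_p] le_q orth_q.
apply/eqP; rewrite -subr_eq0; apply/eqP.
apply: (moment_functional1_orth_eq0 hankel_neq0); first exact: size_subZ_monic.
move=> i lt_im; rewrite mulrBr -scalerAr /moment_functional1 linearB linearZ /=.
by move: (orth_p i lt_im) (orth_q i lt_im); rewrite /moment_functional1 => -> ->;
  rewrite mulr0 subrr.
Qed.

Variables (P P1 : nat -> {poly R}).
Hypotheses (hankel_neq0 : forall n, (1 <= n)%N -> hankel1 c n <> 0)
  (defP : forall n, is_P c n (P n)) (defP1 : forall n, is_P1 c n (P1 n))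
  (orthP : orthogonal_sequence c P).

(** The empty determinant is 1, so proportionality is also available at [m = 0]. *)
Let hankel1_neq0 n : hankel1 c n <> 0.
Proof.
by case: n => [|n]; [rewrite /hankel1 det_mx00; apply/eqP/oner_neq0
                    | exact: hankel_neq0].
Qed.

Let lead_neq0 n : (P n)`_n != 0.
Proof.
have [size_P _] := orthP n.
have := lead_coef_eq0 (P n); rewrite lead_coefE size_P /= => ->.
by rewrite -size_poly_eq0 size_P.
Qed.

Lemma P_succ m : exists2 l : R, l != 0 & P m.+1 = P m + l *: ('X * P1 m).
Proof.
have [size_m1 P0_m1 orth_m1] := defP m.+1; have [size_m P0_m orth_m] := defP m.
have /factor_theorem[q] : root (P m.+1 - P m) 0.
  by rewrite rootE hornerD hornerN P0_m1 P0_m subrr.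
rewrite subr0 mulrC => dPq.
have size_Xq : (size ('X * q)%R <= m.+2)%N.
  rewrite -dPq (leq_trans (size_polyD _ _)) // size_polyN geq_max size_m1.
  by rewrite (leq_trans size_m).
have size_q : (size q <= m.+1)%N.
  apply/leq_sizeP => j le_mj; have /leq_sizeP/(_ j.+1 le_mj) := size_Xq.
  by rewrite coefXM.
have dq : q = q`_m *: P1 m.
  apply: moment_functional1_orth_proportional => // i lt_im.
  (* The factor ['X] hidden in c^(1) turns [q] back into [P m.+1 - P m], both terms of which are
     orthogonal to ['X^i] for [i < m]. *)
  rewrite moment_functional1E mulrCA -dPq mulrBr linearB /=.
  by rewrite orth_m1 ?orth_m ?subrr // ltnS ltnW.
have dP : P m.+1 = P m + 'X * q by rewrite -dPq addrC subrK.
exists q`_m; last by rewrite dP {1}dq scalerAr.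
have := lead_neq0 m.+1; rewrite dP coefD coefXM /=.
by rewrite [(P m)`_m.+1]nth_default // add0r.
Qed.

Lemma P_decomp m : exists a b : R, a != 0 /\ P m.+1 = a *: P1 m.+1 + b *: P1 m.
Proof.
have [size_P _ orth_P] := defP m.+1; have [mon_P1 size_P1 orth_P1] := defP1 m.+1.
set a := (P m.+1)`_m.+1; set q := P m.+1 - a *: P1 m.+1.
exists a, q`_m; split; first exact: lead_neq0.
suff <- : q = q`_m *: P1 m by rewrite addrC subrK.
apply: moment_functional1_orth_proportional => //; first exact: size_subZ_monic.
move=> i lt_im; rewrite /q mulrBr -scalerAr /moment_functional1 linearB linearZ /=.
have := orth_P1 i (ltnW lt_im); rewrite /moment_functional1 => ->.
(* Passing from c^(1) to c raises the exponent by one, so [P m.+1] is c^(1)-orthogonal only for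
   [i < m]; hence the extra term in [P1 m]. *)
have := moment_functional1E ('X^i * P m.+1); rewrite /moment_functional1 => ->.
by rewrite mulr0 subr0 mulrA -exprS orth_P.
Qed.

End Orthogonality.

Theorem proposition3p2 (R : realType) (c : nat -> R)
    (P P1 : nat -> {poly R})
    (hankel_neq0 : forall n : nat, (1 <= n)%N -> hankel1 c n <> 0)
    (defP : forall n : nat, is_P c n (P n))
    (defP1 : forall n : nat, is_P1 c n (P1 n))
    (orthP : orthogonal_sequence c P)
    (k : nat) (hk : (3 <= k)%N) :
  exists A B C D E F G : R,
    P k = A *: (('X^2 + B *: 'X + C%:P) * P (k - 2)%N
                + (D *: 'X^3 + E *: 'X^2 + F *: 'X + G%:P) * P1 (k - 3)%N).
Proof.
case: k hk => [|[|[|m]]] // _; rewrite !subSS !subn0.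
have [l1 l1_neq0 dP2] := P_succ hankel_neq0 defP defP1 orthP m.+1.
have [l2 l2_neq0 dP3] := P_succ hankel_neq0 defP defP1 orthP m.+2.
have [a1 [b1 [a1_neq0 dP1_]]] := P_decomp hankel_neq0 defP defP1 orthP m.
have [a2 [b2 [a2_neq0 dP2_]]] := P_decomp hankel_neq0 defP defP1 orthP m.+1.
have dQ1 : P1 m.+1 = a1^-1 *: (P m.+1 - b1 *: P1 m).
  by rewrite dP1_ addrK scalerA mulVf // scale1r.
have dQ2 : P1 m.+2 = a2^-1 *: (P m.+2 - b2 *: P1 m.+1).
  by rewrite dP2_ addrK scalerA mulVf // scale1r.
pose u1 := l1 * a1^-1; pose u2 := l2 * a2^-1; pose w := u1 * u2.
have w_neq0 : w != 0 by rewrite !mulf_neq0 ?invr_neq0.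
(* Eliminating [P1 m.+2], [P m.+2] and [P1 m.+1] gives [P m.+3] as (w x^2 + B x + 1) [P m.+1] + (- w
   b1 x^2 + F x) [P1 m]; the witnesses come from factoring out [w]. *)
pose B := u1 + u2 - u2 * b2 * a1^-1.
pose F := u2 * b2 * a1^-1 * b1 - u1 * b1.
exists w, (w^-1 * B), w^-1, 0, (- b1), (w^-1 * F), 0.
(* Distributing [w] cancels every inverse of [w], so that [ring] has no inverse left to simplify. *)
rewrite scalerDr !scalerAl !scalerDr !scalerA !mulVKf // -!mul_polyC -!polyCM.
rewrite divff // dP3 dQ2 dP2 dQ1 -!mul_polyC /B /F /w /u1 /u2.
by rewrite !(polyCM, polyCD, polyCN, polyC0, polyC1); ring.
Qed.
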